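(* Let $0<\alpha<1$, let $n\ge 1$ be an integer, $h=1/n$, $x_j=jh$ for $0\le j\le n$, and let $1\le k\le n$. Let $\varphi\in C^2[0,x_k]$, and let $K:[0,1]\times[0,1]\to\mathbb{R}$ be continuous with $|K(x,\tau)|\le M$ for all $0\le x,\tau\le 1$, where $M>0$. Let $E^k(\varphi,h,\alpha)$ be the error at $x_k$ of the Linear scheme (S1) for the equation $D^\alpha\varphi(x)=f(x)+\int_0^x K(x,\tau)\varphi(\tau)\,d\tau$. Then $$\left|E^k(\varphi,h,\alpha)\right|\le \frac{1}{\Gamma(1-\alpha)}\left[\frac18+\frac{\alpha}{(1-\alpha)(2-\alpha)}\right]\max_{x_0\le\tau\le x_k}|\varphi''(\tau)|\,h^{2-\alpha}+\frac{M}{8}\max_{x_0\le\tau\le x_k}|\varphi''(\tau)|\,x_k h^2 .$$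
   Context: For $0<\alpha<1$ the Caputo derivative is $D^\alpha\varphi(x)=\frac{1}{\Gamma(1-\alpha)}\int_0^x (x-\tau)^{-\alpha}\varphi'(\tau)\,d\tau$. The problem considered is $D^\alpha\varphi(x)=f(x)+\int_0^x K(x,\tau)\varphi(\tau)\,d\tau$ on $0\le x\le 1$, with $\varphi(0)=\delta$ prescribed. Write $\varphi_j=\varphi(x_j)$. Linear scheme (S1): on each $[x_j,x_{j+1}]$, $0\le j\le k-1$, replace $\varphi$ by its linear interpolant $$\varphi_{1j}(\tau)=\frac{x_{j+1}-\tau}{h}\varphi_j+\frac{\tau-x_j}{h}\varphi_{j+1},$$ both in the Caputo derivative term (where $\varphi'$ is replaced by $\varphi_{1j}'=(\varphi_{j+1}-\varphi_j)/h$) and in the integral term of the equation at $x=x_k$. The error of the scheme at $x_k$ is the error committed by this replacement: $$E^k(\varphi,h,\alpha)=\frac{1}{\Gamma(1-\alpha)}\sum_{j=0}^{k-1}\int_{x_j}^{x_{j+1}}(x_k-\tau)^{-\alpha}\left(\varphi'(\tau)-\frac{\varphi_{j+1}-\varphi_j}{h}\right)d\tau-\sum_{j=0}^{k-1}\int_{x_j}^{x_{j+1}}K(x_k,\tau)\left(\varphi(\tau)-\varphi_{1j}(\tau)\right)d\tau .$$ *)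

(* Defs.v *)
From HB Require Import structures.
From mathcomp Require Import all_boot all_order all_algebra.
From mathcomp Require Import all_classical all_reals all_analysis.

Set Implicit Arguments.
Unset Strict Implicit.
Unset Printing Implicit Defensive.

Import Order.TTheory GRing.Theory Num.Theory.
Import numFieldNormedType.Exports.

Local Open Scope classical_set_scope.
Local Open Scope ring_scope.

(* Derivative relative to a set A: only values of f on A are used, so that at
   an endpoint of a closed interval it is the one-sided derivative.  (The
   library's [derivable] and [derive1] are two-sided at every point.) *)
Definition diff_quot (R : realType) (f : R -> R) (x : R) : R -> R :=
  fun y => (f y - f x) / (y - x).

Definition derivable1_on (R : realType) (A : set R) (f : R -> R) (x : R) :
    Prop :=
  cvg (diff_quot f x @ within A x^').

Definition derive1_on (R : realType) (A : set R) (f : R -> R) : R -> R :=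
  fun x => lim (diff_quot f x @ within A x^').

(* phi \in C^2[a, b]; continuity of phi and phi' on [a, b] follows from their
   differentiability there. *)
Definition C2_on (R : realType) (a b : R) (phi : R -> R) : Prop :=
  let A := `[a, b]%classic in
  [/\ forall x, A x -> derivable1_on A phi x,
      forall x, A x -> derivable1_on A (derive1_on A phi) x
    & {within A, continuous (derive1_on A (derive1_on A phi))}].

(* The maximum of a real function over [a, b]; see [max_on_attained]. *)
Definition max_on (R : realType) (a b : R) (g : R -> R) : R :=
  sup [set g t | t in `[a, b]].

Lemma max_on_attained (R : realType) (a b : R) (g : R -> R) : a <= b ->
  {within `[a, b], continuous g} ->
  exists2 c, c \in `[a, b] & max_on a b g = g c /\
    (forall t, t \in `[a, b] -> g t <= g c).
Proof.
move=> ab cg; have [c cab cmax] := EVT_max ab cg.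
exists c => //; split=> //; apply/eqP; rewrite eq_le; apply/andP; split.
  apply: ge_sup; first by exists (g c), c.
  by move=> _ [t tab <-]; exact: cmax.
apply: ub_le_sup; last by exists c.
by exists (g c) => _ [t tab <-]; exact: cmax.
Qed.

(* Euler's integral, for s > 0. *)
Definition Gamma (R : realType) (s : R) : R :=
  \int[@lebesgue_measure R]_(t in `]0, +oo[) (t `^ (s - 1) * expR (- t)).

Definition node (R : realType) (h : R) (j : nat) : R := j%:R * h.

Definition slope (R : realType) (phi : R -> R) (h : R) (j : nat) : R :=
  (phi (node h j.+1) - phi (node h j)) / h.

Definition interpolant (R : realType) (phi : R -> R) (h : R) (j : nat) :
    R -> R :=
  fun tau => (node h j.+1 - tau) / h * phi (node h j)
             + (tau - node h j) / h * phi (node h j.+1).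

(* E^k(phi, h, alpha); phi' is the derivative of phi on [x_0, x_k].  The last
   integral of the first sum has an integrable singularity at tau = x_k, where
   [0 `^ (- alpha)] takes the (irrelevant) value 0. *)
Definition linear_scheme_error (R : realType) (K : R * R -> R) (k : nat)
    (phi : R -> R) (h alpha : R) : R :=
  let x := node h in
  let dphi := derive1_on `[x 0%N, x k] phi in
  (Gamma (1 - alpha))^-1 *
    \sum_(0 <= j < k)
      \int[@lebesgue_measure R]_(tau in `[x j, x j.+1])
        ((x k - tau) `^ (- alpha) * (dphi tau - slope phi h j))
  - \sum_(0 <= j < k)
      \int[@lebesgue_measure R]_(tau in `[x j, x j.+1])
        (K (x k, tau) * (phi tau - interpolant phi h j tau)).

(* Main.v *)
Require Import Defs.
From HB Require Import structures.
From mathcomp Require Import all_boot all_order all_algebra.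
From mathcomp Require Import all_classical all_reals all_analysis.
From mathcomp Require Import measurable_realfun ring lra.

Set Implicit Arguments.
Unset Strict Implicit.
Unset Printing Implicit Defensive.

Import Order.TTheory GRing.Theory Num.Theory.
Import numFieldNormedType.Exports.

Local Open Scope classical_set_scope.
Local Open Scope ring_scope.

(** Write [g] for [phi] minus its piecewise linear interpolant, [X] for the
    node [x_k], [m] for the maximum of [|phi''|] and [w t = (X - t) ^ - alpha].
    The Caputo part of the error is [\sum_j \int w * g'] over the mesh cells,
    up to the factor [1 / Gamma (1 - alpha)], and [g] vanishes at every node.

    On a cell [[a, b]] with [b < X] the weight is smooth, so integrating by
    parts gives [\int w * g' = - \int w' * g].  As [|g| <= m h^2 / 8] and
    [w' >= 0], this is at most [m h^2 / 8 * (w b - w a)]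
    ([Rintegral_powR_rev_chord_interior_le]).  The sum over these cells
    telescopes, and [w] equals [h ^ - alpha] at the last interior node: this is
    the term with the constant [1 / 8].

    On the last cell [[a, X]] the weight is singular at [X], and the boundary
    term of an integration by parts would be of the form [oo * 0].  It is
    avoided by using [\int g' = 0] to replace [w] by the nonnegative weight
    [w - w a], together with the bound [|g'| <= m h / 2].  Since
    [\int (w - w a) = h ^ (1 - alpha) * alpha / (1 - alpha)], the cell
    contributes at most [m / 2 * alpha / (1 - alpha) * h ^ (2 - alpha)]
    ([Rintegral_powR_rev_chord_le]), and [1 / 2 <= 1 / (2 - alpha)].

    The kernel part follows from [|K| <= M] and [|g| <= m h^2 / 8], on [k] cells
    of length [h] ([kernel_error_le]).

    The two pointwise bounds on the interpolation error ([chord_error_le] and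
    [slope_error_le]) come from Rolle's theorem and a Taylor expansion. *)

(** * Derivatives relative to a set *)

(** [f y] is the difference quotient times [y - x], plus [f x]; the first
    summand tends to [0].  The filter is arbitrary so as to cover one-sided
    limits. *)
Lemma diff_quot_cvg_continuous (R : realType) (F : set_system R) (f : R -> R)
    (x : R) :
  Filter F -> id @ F --> x -> (\forall y \near F, y != x) ->
  cvg (diff_quot f x @ F) -> f @ F --> f x.
Proof.
move=> FF Fx Nx df.
have d0 : (y - x) @[y --> F] --> (0 : R).
  by rewrite -(subrr x); exact: (cvgB Fx (cvg_cst x)).
have H : diff_quot f x y * (y - x) + f x @[y --> F] --> f x.
  by rewrite -[X in _ --> X](add0r (f x)) -(mulr0 (lim (diff_quot f x @ F)));
    exact: (cvgD (cvgM df d0) (cvg_cst _)).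
apply: cvg_trans H; apply: near_eq_cvg; apply: filterS Nx => y yx.
by rewrite /diff_quot divfK ?subrK// subr_eq0.
Qed.

Lemma derivable1_on_continuous (R : realType) (A : set R) (f : R -> R) :
  (forall x, A x -> derivable1_on A f x) -> {within A, continuous f}.
Proof.
move=> df; apply/subspace_continuousP => x Ax.
have fx0 : f y @[y --> within A x^'] --> f x.
  apply: diff_quot_cvg_continuous (df x Ax).
  - by move=> P xP; apply: filterS xP => y Py _ _.
  - suff : \forall y \near nbhs x, y != x -> A y -> y != x by [].
    by apply: nearW => y yx _.
move=> P Pfx.
have : \forall y \near x, y != x -> A y -> P (f y) := fx0 P Pfx.
apply: (@filterS _ (nbhs x)) => y /= Py Ay.
have [->|yx] := eqVneq y x; first exact: nbhs_singleton.
exact: Py.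
Qed.

Lemma derivable1_on_is_derive (R : realType) (A : set R) (f : R -> R) (x : R) :
  nbhs x A -> derivable1_on A f x -> is_derive x 1 f (derive1_on A f x).
Proof.
move=> Ax dfx.
suff q : (fun h : R => h^-1 *: ((f \o shift x) (h *: (1 : R)) - f x)) @ 0^' -->
    derive1_on A f x.
  by split; [apply/cvg_ex; exists (derive1_on A f x)|exact: cvg_lim q].
apply/cvgrPdist_lt => e e0.
have : \forall y \near within A x^', `|derive1_on A f x - diff_quot f x y| < e.
  by move/cvgrPdist_lt : dfx; exact.
rewrite /prop_near1 /within /=.
move=> /nbhs_ballP[d1 /= d10 H1]; move/nbhs_ballP : Ax => [d2 /= d20 H2].
near=> h.
have hd1 : ball x d1 (h + x).
  rewrite /ball /= opprD addrCA subrr addr0 normrN.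
  by near: h; exact: dnbhs0_lt.
have hd2 : ball x d2 (h + x).
  rewrite /ball /= opprD addrCA subrr addr0 normrN.
  by near: h; exact: dnbhs0_lt.
have h0 : h != 0 by near: h; exact: nbhs_dnbhs_neq.
have := H1 _ hd1 _ (H2 _ hd2).
rewrite /diff_quot /= addrK -subr_eq0 addrK h0 => /(_ isT).
by rewrite [h *: 1]mulr1 [_ *: _]mulrC.
Unshelve. all: by end_near. Qed.

(** * Linear interpolation of functions with bounded second derivative *)

Section curvature.
Context {R : realType}.
Implicit Types (f : R -> R) (a b m : R).

(** The form in which C^2 regularity is used: [f1] stands for the derivative of
    [f], one-sided at [a] and [b], and only a bound on the derivative of [f1]
    inside the interval is kept.  This form restricts to subintervals, on which
    the derivatives relative to the whole interval need not be recomputed. *)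
Record curvature_le f (f1 : R -> R) m a b : Prop := CurvatureLe {
  curv_cont0 : {within `[a, b], continuous f} ;
  curv_derive0 : forall x, x \in `]a, b[ -> is_derive x 1 f (f1 x) ;
  curv_cont1 : {within `[a, b], continuous f1} ;
  curv_derive1 : forall x, x \in `]a, b[ ->
    exists2 d : R, is_derive x 1 f1 d & `|d| <= m }.

(** Auxiliary polynomials for Rolle's theorem; the family is stable under
    differentiation, so the same lemmas serve [f - quad] and its derivative. *)
Definition quad (u v c z : R) : R -> R :=
  fun s => u + v * (s - z) + c * (s - z) ^+ 2.

Lemma is_derive_quad u v c z (s : R) :
  is_derive s 1 (quad u v c z) (quad v (c *+ 2) 0 z s).
Proof.
rewrite /quad; apply: is_derive_eq.
by rewrite /GRing.scale /=; ring.
Qed.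

Lemma continuous_quad u v c z : continuous (quad u v c z).
Proof.
move=> s; apply/differentiable_continuous/derivable1_diffP.
by case: (is_derive_quad u v c z s).
Qed.

Lemma within_continuous_subquad (A : set R) f u v c z :
  {within A, continuous f} ->
  {within A, continuous (f - quad u v c z)}.
Proof.
move=> cf; apply: within_continuousB => //.
by apply: continuous_subspaceT; exact: continuous_quad.
Qed.

Lemma itv_subset_trans a b (x y : R) :
  x \in `[a, b] -> y \in `[a, b] -> `[x, y] `<=` `[a, b].
Proof.
rewrite !in_itv/= => /andP[ax xb] /andP[ay yb] z/=.
rewrite !in_itv/= => /andP[? ?].
by apply/andP; split; lra.
Qed.

Lemma curvature_leW f (f1 : R -> R) m a b (x y : R) :
  x \in `[a, b] -> y \in `[a, b] ->
  curvature_le f f1 m a b -> curvature_le f f1 m x y.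
Proof.
move=> xab yab [cf df cf1 df1].
have sub : forall z, z \in `]x, y[ -> z \in `]a, b[.
  move: xab yab => /[!in_itv]/= /andP[? ?] /andP[? ?] z.
  by rewrite !in_itv/= => /andP[? ?]; apply/andP; split; lra.
split.
- by apply: continuous_subspaceW cf; exact: itv_subset_trans.
- by move=> z /sub; exact: df.
- by apply: continuous_subspaceW cf1; exact: itv_subset_trans.
- by move=> z /sub; exact: df1.
Qed.

Lemma curvature_le_lip f (f1 : R -> R) m a b (x y : R) :
  curvature_le f f1 m a b ->
  x \in `[a, b] -> y \in `[a, b] -> `|f1 x - f1 y| <= m * `|x - y|.
Proof.
wlog xy : x y / x <= y.
  move=> H C xab yab; have [xy|yx] := leP x y; first exact: H.
  by rewrite distrC (distrC x); apply: H => //; exact: ltW.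
move=> C xab yab; move: xy; rewrite le_eqVlt => /predU1P[->|xy].
  by rewrite !subrr normr0 mulr0.
have [_ _ cf1 df1] := curvature_leW xab yab C.
have [||z zxy] := @MVT R f1 (derive1 f1) x y xy.
- move=> z /df1 [d dz _]; rewrite derive1E; exact/derivableP/ex_derive.
- exact: cf1.
have [d dz dm] := df1 _ zxy.
rewrite derive1E derive_val => E.
by rewrite distrC E normrM (distrC x) ler_wpM2r.
Qed.

Lemma curvature_ge0 f (f1 : R -> R) m a b :
  a < b -> curvature_le f f1 m a b -> 0 <= m.
Proof.
move=> ab C; have aa : a \in `[a, b] by rewrite in_itv/= lexx ltW.
have bb : b \in `[a, b] by rewrite in_itv/= lexx ltW.
have := le_trans (normr_ge0 _) (curvature_le_lip C aa bb).
by rewrite pmulr_lge0// normr_gt0 subr_eq0 lt_eqF.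
Qed.

(** If [c] is the second order divided difference at [z, z, x], the function
    [s |-> f s - f z - f1 z * (s - z) - c * (s - z)^2] vanishes at [x] and [z],
    so its derivative vanishes at some [y] between them, where
    [f1 y - f1 z = c *+ 2 * (y - z)].  The Lipschitz bound on [f1] then bounds
    [c].  The points may come in either order. *)
Lemma taylor1_le f f1 m a b (x z : R) : curvature_le f (f1 : R -> R) m a b ->
  x \in `[a, b] -> z \in `[a, b] ->
  `|f x - f z - f1 z * (x - z)| <= m / 2 * (x - z) ^+ 2.
Proof.
move=> C xab zab; have [->|xz] := eqVneq x z.
  by rewrite !subrr mulr0 subr0 normr0 expr0n mulr0.
have xz0 : (x - z) ^+ 2 != 0 by rewrite expf_neq0// subr_eq0.
pose c := (f x - f z - f1 z * (x - z)) / (x - z) ^+ 2.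
have cE : f x - f z - f1 z * (x - z) = c * (x - z) ^+ 2 by rewrite /c divfK.
pose lo := Num.min x z; pose hi := Num.max x z.
have lohi : lo < hi.
  by move: xz; rewrite /lo /hi neq_lt; case: (ltP x z) => //= ? /orP[]//; lra.
have loab : lo \in `[a, b] by rewrite /lo; case: (ltP x z).
have hiab : hi \in `[a, b] by rewrite /hi; case: (ltP x z).
have [cf df _ _] := curvature_leW loab hiab C.
pose q := quad (f z) (f1 z) c z.
have qx : (f - q) x = 0 by rewrite !fctE /q /quad; lra.
have qz : (f - q) z = 0 by rewrite !fctE /q /quad subrr; ring.
have dq s : s \in `]lo, hi[ ->
    is_derive s 1 (f - q) (f1 s - quad (f1 z) (c *+ 2) 0 z s).
  move=> /df fs; have qs := is_derive_quad (f z) (f1 z) c z s.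
  exact: is_deriveB.
have [||| y ylh y0] := @Rolle R (f - q) lo hi lohi.
- by move=> s /dq sq; exact: ex_derive.
- exact: within_continuous_subquad.
- by rewrite /lo /hi; case: (ltP x z); rewrite ?qx ?qz.
have := dq _ ylh => /(@derive_val _ _ _ _ _ _ _).
rewrite (@derive_val _ _ _ _ _ _ _ y0).
rewrite /quad mul0r addr0 => e.
have yz : y != z.
  apply/eqP => yz; move: ylh; rewrite in_itv/= /lo /hi yz.
  by case: (ltP x z) => h /andP[h1 h2]; lra.
have yab : y \in `[a, b].
  move: ylh loab hiab; rewrite !in_itv/= => /andP[? ?] /andP[? ?] /andP[? ?].
  by apply/andP; split; lra.
have := curvature_le_lip C yab zab.
have -> : f1 y - f1 z = c *+ 2 * (y - z) by lra.
rewrite normrM ler_pM2r ?normr_gt0 ?subr_eq0// => cm.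
rewrite cE normrM [X in _ * X]ger0_norm ?sqr_ge0// ler_wpM2r ?sqr_ge0//.
by move: cm; rewrite normrMn; lra.
Qed.

Definition chord_slope f a b : R := (f b - f a) / (b - a).

Definition chord f a b : R -> R := quad (f a) (chord_slope f a b) 0 a.

Lemma chordl f a b : chord f a b a = f a.
Proof. by rewrite /chord /quad subrr; ring. Qed.

Lemma chordr f a b : a < b -> chord f a b b = f b.
Proof.
move=> ab; rewrite /chord /quad /chord_slope divfK ?subr_eq0 ?gt_eqF//.
by ring.
Qed.

(** The difference of the expansions of [f a] and [f b] at [t] gives
    [m / 2 * ((t - a)^2 + (b - t)^2)], a sum of squares of two lengths that add
    up to [b - a].  At [t = a] the constant is optimal; the last cell of the
    scheme needs it. *)
Lemma slope_error_le f (f1 : R -> R) m a b (t : R) : a < b ->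
  curvature_le f f1 m a b -> t \in `[a, b] ->
  `|f1 t - chord_slope f a b| <= m / 2 * (b - a).
Proof.
move=> ab C tab.
have ba0 : 0 < b - a by rewrite subr_gt0.
have aab : a \in `[a, b] by rewrite in_itv/= lexx ltW.
have bab : b \in `[a, b] by rewrite in_itv/= lexx ltW.
have m0 := curvature_ge0 ab C.
have Ta := taylor1_le C aab tab; have Tb := taylor1_le C bab tab.
suff : `|(f1 t - chord_slope f a b) * (b - a)| <= m / 2 * (b - a) * (b - a).
  by rewrite normrM (gtr0_norm ba0) ler_pM2r.
have -> : (f1 t - chord_slope f a b) * (b - a) =
    (f a - f t - f1 t * (a - t)) - (f b - f t - f1 t * (b - t)).
  by rewrite mulrBl /chord_slope divfK ?gt_eqF//; ring.
apply: (le_trans (ler_normB _ _)); apply: (le_trans (lerD Ta Tb)).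
rewrite -mulrDr -mulrA ler_wpM2l ?divr_ge0//.
by move: tab; rewrite in_itv/= => /andP[? ?]; nra.
Qed.

(** The quadratic polynomial that agrees with [f] at [a], [t] and [b] has second
    derivative [- c *+ 2]; applying Rolle's theorem to the difference, on
    [[a, t]] and [[t, b]], and then to its derivative, yields a point where the
    second derivative of [f] takes this value. *)
Lemma Rolle_curvature f (f1 : R -> R) m a b (t c : R) : t \in `]a, b[ ->
  curvature_le f f1 m a b ->
  f t = chord f a b t + c * ((t - a) * (b - t)) -> `|c| <= m / 2.
Proof.
rewrite in_itv/= => /andP[ta tb] C ft.
have ab : a < b by exact: lt_trans tb.
have [cf df cf1 df1] := C.
(* [v] is the slope at [a] of [chord f a b + c * (s - a) * (b - s)]. *)
pose v := chord_slope f a b + c * (b - a).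
pose p : R -> R := f - quad (f a) v (- c) a.
pose p1 : R -> R := f1 - quad v (- c *+ 2) 0 a.
have cp : {within `[a, b], continuous p} by exact: within_continuous_subquad.
have cp1 : {within `[a, b], continuous p1} by exact: within_continuous_subquad.
have dp s : s \in `]a, b[ -> is_derive s 1 p (p1 s).
  move=> /df fs; have qs := is_derive_quad (f a) v (- c) a s.
  exact: is_deriveB.
have pa : p a = 0 by rewrite /p !fctE /quad subrr; ring.
have pb : p b = 0.
  rewrite /p !fctE /quad /v /chord_slope.
  have : (f b - f a) / (b - a) * (b - a) = f b - f a.
    by rewrite divfK// subr_eq0 gt_eqF.
  by move: (_ / _) => w; nra.
have pt : p t = 0 by rewrite /p !fctE ft /v /chord /quad; ring.
have rolle0 x y : x < y -> x \in `[a, b] -> y \in `[a, b] ->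
    p x = 0 -> p y = 0 ->
    exists2 z, z \in `]x, y[ & p1 z = 0.
  move=> xy xab yab px py.
  have sub z : z \in `]x, y[ -> z \in `]a, b[.
    move: xab yab => /[!in_itv]/= /andP[? ?] /andP[? ?] /andP[? ?].
    by apply/andP; split; lra.
  have [||| z zxy z0] := @Rolle R p x y xy.
  - by move=> s /sub/dp sq; exact: ex_derive.
  - by apply: continuous_subspaceW cp; exact: itv_subset_trans.
  - by rewrite px py.
  exists z => //; have := dp _ (sub _ zxy).
  move=> /(@derive_val _ _ _ _ _ _ _) <-.
  by rewrite (@derive_val _ _ _ _ _ _ _ z0).
have aab : a \in `[a, b] by rewrite in_itv/= lexx ltW.
have bab : b \in `[a, b] by rewrite in_itv/= lexx ltW.
have tab : t \in `[a, b] by rewrite in_itv/= !ltW.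
have [x xat px] := rolle0 _ _ ta aab tab pa pt.
have [y ytb py] := rolle0 _ _ tb tab bab pt pb.
move: xat ytb; rewrite !in_itv/= => /andP[ax xt] /andP[ty yb].
have xy : x < y by exact: lt_trans ty.
have sub z : z \in `]x, y[ -> z \in `]a, b[.
  by rewrite !in_itv/= => /andP[? ?]; apply/andP; split; lra.
have [||| z zxy z0] := @Rolle R p1 x y xy.
- move=> s /sub/df1[d sd _]; have qs := is_derive_quad v (- c *+ 2) 0 a s.
  by case: (is_deriveB sd qs).
- by apply: continuous_subspaceW cp1; apply: itv_subset_trans;
    rewrite in_itv/=; apply/andP; split; lra.
- by rewrite px py.
have [d sd dm] := df1 _ (sub _ zxy).
have qs := is_derive_quad v (- c *+ 2) 0 a z.
have := is_deriveB sd qs => /(@derive_val _ _ _ _ _ _ _).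
rewrite (@derive_val _ _ _ _ _ _ _ z0) /quad => e.
have dE : d = - c *+ 2 by lra.
by move: dm; rewrite dE normrMn normrN; lra.
Qed.

Lemma chord_error_le f (f1 : R -> R) m a b (t : R) : a < b ->
  curvature_le f f1 m a b -> t \in `[a, b] ->
  `|f t - chord f a b t| <= m / 8 * (b - a) ^+ 2.
Proof.
move=> ab C tab; have m0 := curvature_ge0 ab C.
have rhs0 : 0 <= m / 8 * (b - a) ^+ 2 by rewrite mulr_ge0 ?sqr_ge0 ?divr_ge0.
have [->|ta] := eqVneq t a; first by rewrite chordl subrr normr0.
have [->|tb] := eqVneq t b; first by rewrite chordr// subrr normr0.
have tI : t \in `]a, b[.
  by move: tab; rewrite !in_itv/= !lt_neqAle eq_sym ta tb.
have w0 : 0 < (t - a) * (b - t).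
  by move: tI; rewrite in_itv/= => /andP[? ?]; rewrite mulr_gt0// subr_gt0.
pose c := (f t - chord f a b t) / ((t - a) * (b - t)).
have cE : f t - chord f a b t = c * ((t - a) * (b - t)).
  by rewrite /c divfK// gt_eqF.
have cm : `|c| <= m / 2.
  by apply: (Rolle_curvature tI C); rewrite -cE addrCA subrr addr0.
rewrite cE normrM (gtr0_norm w0).
apply: le_trans (_ : m / 2 * ((t - a) * (b - t)) <= _).
  by rewrite ler_pM2r.
have : (t - a) * (b - t) <= (b - a) ^+ 2 / 4.
  have := sqr_ge0 ((t - a) - (b - t)); lra.
have : 0 <= m / 2 by rewrite divr_ge0.
move: (_ * (b - t)) => w m2 wle.
apply: le_trans (ler_wpM2l m2 wle) _; rewrite le_eqVlt; apply/orP; left.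
by apply/eqP; field.
Qed.

End curvature.

(** * Integrals against a nonnegative weight *)

Section weight.
Context d (T : measurableType d) (R : realType).
Context (mu : {measure set T -> \bar R}).

Lemma integrable_weight (D : set T) (u v : T -> R) (C : R) : measurable D ->
  mu.-integrable D (EFin \o u) -> measurable_fun D v ->
  (forall t, D t -> `|v t| <= C) ->
  mu.-integrable D (EFin \o (fun t => u t * v t)).
Proof.
move=> mD iu mv vC.
have mu_u : measurable_fun D u.
  by apply/measurable_EFinP; exact: measurable_int iu.
apply: (@le_integrable _ _ _ mu D mD _ (fun t => (C * u t)%:E)).
- by apply/measurable_EFinP; exact: measurable_funM.
- move=> t Dt; rewrite !abse_EFin lee_fin !normrM mulrC ler_wpM2r//.
  by apply: le_trans (vC _ Dt) _; exact: ler_norm.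
- exact: (integrableZl mD C iu).
Qed.

Lemma le_normr_Rintegral_weight (D : set T) (u v : T -> R) (C : R) :
  measurable D ->
  mu.-integrable D (EFin \o u) -> measurable_fun D v ->
  (forall t, D t -> 0 <= u t) -> (forall t, D t -> `|v t| <= C) ->
  `|\int[mu]_(t in D) (u t * v t)| <= C * \int[mu]_(t in D) u t.
Proof.
move=> mD iu mv u0 vC.
have iuv := integrable_weight mD iu mv vC.
apply: le_trans (le_normr_Rintegral mD iuv) _.
rewrite -RintegralZl//; apply: le_Rintegral => //.
- exact: integrable_norm iuv.
- exact: (integrableZl mD C iu).
- move=> t Dt; rewrite normrM (ger0_norm (u0 _ Dt)) mulrC ler_wpM2r//.
    exact: u0.
  exact: vC.
Qed.

End weight.

Section weighted_integrals.
Context {R : realType}.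
Notation mu := (@lebesgue_measure R).
Implicit Types (f w F : R -> R) (a b m t C X p : R).

Lemma within_continuous_integrable f a b : {within `[a, b], continuous f} ->
  mu.-integrable `[a, b] (EFin \o f).
Proof.
move=> cf; apply: continuous_compact_integrable => //.
exact: segment_compact.
Qed.

(** The form of differentiability up to the boundary that the fundamental
    theorem of calculus and integration by parts take as hypotheses. *)
Lemma derivable_LRcontinuous F (F1 : R -> R) a b : a < b ->
  {within `[a, b], continuous F} ->
  (forall x, x \in `]a, b[ -> is_derive x 1 F (F1 x)) ->
  derivable_oo_LRcontinuous F a b /\ {in `]a, b[, F^`()%classic =1 F1}.
Proof.
move=> ab cF dF; split.
  have [_ cl cr] := (continuous_within_itvP F ab).1 cF.
  by split => // x /dF[].
by move=> x /dF xF; rewrite derive1E derive_val.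
Qed.

Lemma Rintegral_derive F (F1 : R -> R) a b : a < b ->
  {within `[a, b], continuous F} -> {within `[a, b], continuous F1} ->
  (forall x, x \in `]a, b[ -> is_derive x 1 F (F1 x)) ->
  \int[mu]_(x in `[a, b]) F1 x = F b - F a.
Proof.
move=> ab cF cF1 dF; have [LR D] := derivable_LRcontinuous ab cF dF.
by rewrite /Rintegral (continuous_FTC2 ab cF1 LR D).
Qed.

Lemma Rintegral_itv_one a b : a <= b -> \int[mu]_(t in `[a, b]) (1 : R) = b - a.
Proof.
move=> ab; rewrite Rintegral_cst//= lebesgue_measure_itv/= lte_fin mul1r.
by move: ab; rewrite le_eqVlt => /predU1P[->|->//]; rewrite ltxx subrr.
Qed.

(** * The weight [(X - t) ^ p] *)

Lemma chord_is_derive f a b t (d : R) : is_derive t 1 f d ->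
  is_derive t 1 (f - chord f a b) (d - chord_slope f a b).
Proof.
move=> ft; have ct := is_derive_quad (f a) (chord_slope f a b) 0 a t.
have := is_deriveB ft ct; congr (is_derive _ _ _ (_ - _)).
by rewrite /quad mul0rn; ring.
Qed.

(** Integration by parts, without boundary terms since [f - chord f a b]
    vanishes at [a] and [b]; the monotone weight then has total variation
    [w b - w a]. *)
Lemma Rintegral_weight_chord_le f (f1 : R -> R) m w (w1 : R -> R) a b : a < b ->
  curvature_le f f1 m a b ->
  {within `[a, b], continuous w} -> {within `[a, b], continuous w1} ->
  (forall t, t \in `]a, b[ -> is_derive t 1 w (w1 t)) ->
  (forall t, t \in `[a, b] -> 0 <= w1 t) ->
  `|\int[mu]_(t in `[a, b]) (w t * (f1 t - chord_slope f a b))|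
    <= m / 8 * (b - a) ^+ 2 * (w b - w a).
Proof.
move=> ab C cw cw1 dw w10; have [cf df cf1 _] := C.
have cG : {within `[a, b], continuous (f - chord f a b)}.
  exact: within_continuous_subquad.
have cg : {within `[a, b], continuous (fun t => f1 t - chord_slope f a b)}.
  by move=> t; apply: cvgB; [exact: cf1|exact: cvg_cst].
have [LRw Dw] := derivable_LRcontinuous ab cw dw.
have [LRG DG] := derivable_LRcontinuous ab cG
  (fun t tab => chord_is_derive a b (df t tab)).
rewrite (Rintegration_by_parts ab cw1 LRw Dw cg LRG DG) !fctE.
rewrite chordl chordr// !subrr !mulr0 subrr add0r normrN.
rewrite -(Rintegral_derive ab cw cw1 dw).
apply: le_normr_Rintegral_weight => //.
- exact: within_continuous_integrable.
- by apply: subspace_continuous_measurable_fun.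
- by move=> t tab; exact: chord_error_le C tab.
Qed.

Lemma is_derive_powR_rev X p t : t < X ->
  is_derive t 1 (fun s => (X - s) `^ p) (- p * (X - t) `^ (p - 1)).
Proof.
move=> tX; have Xt : 0 < X - t by rewrite subr_gt0.
have dX : is_derive t 1 (fun s : R => X - s) (- 1).
  by apply: is_derive_eq; ring.
have := @is_derive1_comp R (fun u => u `^ p) (fun s => X - s) t _ _
  (is_derive1_powR p Xt) dX.
by rewrite mulrN1 mulNr.
Qed.

Lemma within_continuous_powR_rev X p a b : b < X ->
  {within `[a, b], continuous (fun s => (X - s) `^ p)}.
Proof.
move=> bX; apply: derivable_within_continuous => t.
rewrite in_itv/= => /andP[_ tb].
by case: (is_derive_powR_rev p (le_lt_trans tb bX)).
Qed.

(** The fundamental theorem on [[a, X - 1 / (n + 1)]], where the weight is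
    continuous even if [p < 0], followed by monotone convergence. *)
Lemma le_integral_powR_rev X p a : a < X -> -1 < p ->
  (\int[mu]_(t in `[a, X[) ((X - t) `^ p)%:E <=
    ((X - a) `^ (p + 1) / (p + 1))%:E)%E.
Proof.
move=> aX p1; have q0 : 0 < p + 1 by lra.
have rhs0 : 0 <= (X - a) `^ (p + 1) / (p + 1).
  by rewrite divr_ge0 ?powR_ge0 ?ltW.
rewrite itv_bnd_open_bigcup.
have Fcvg :
  (\int[mu]_(t in `[a, (X - n.+1%:R^-1)%R]) ((X - t) `^ p)%:E)%E
    @[n --> \oo] -->
  (\int[mu]_(t in \bigcup_n `[a, (X - n.+1%:R^-1)%R]%classic)
    ((X - t) `^ p)%:E)%E.
  apply: ge0_nondecreasing_set_cvg_integral.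
  - move=> i j ij; rewrite subsetEset; apply: subset_itvl; rewrite bnd_simp.
    by rewrite lerB// lef_pV2 ?posrE ?ltr0n// ler_nat ltnS.
  - by move=> i.
  - move=> i; apply/measurable_EFinP.
    have cw : {within `[a, X - i.+1%:R^-1], continuous (fun s => (X - s) `^ p)}.
      by apply: within_continuous_powR_rev; rewrite ltrBlDr ltrDl invr_gt0.
    exact: subspace_continuous_measurable_fun cw.
  - by move=> i t _; rewrite lee_fin powR_ge0.
rewrite -(cvg_lim _ Fcvg)//; apply: lime_le.
  by apply/cvg_ex; eexists; exact: Fcvg.
apply: nearW => n; set e := n.+1%:R^-1.
have e0 : 0 < e by rewrite invr_gt0.
have [aXe|Xea] := ltP a (X - e); last first.
  move: Xea; rewrite le_eqVlt => /predU1P[->|Xea].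
    by rewrite set_itv1 integral_set1 lee_fin.
  by rewrite set_itv_ge ?bnd_simp -?ltNge// integral_set0 lee_fin.
have XeX : X - e < X by rewrite ltrBlDr ltrDl.
(* The value of this antiderivative at the right endpoint is nonpositive. *)
pose F := fun t : R => - (p + 1)^-1 * (X - t) `^ (p + 1).
have dF t : t < X -> is_derive t 1 F ((X - t) `^ p).
  move=> tX; have := is_derive_powR_rev (p + 1) tX => dG.
  have := is_deriveZ (- (p + 1)^-1) dG; congr (is_derive _ _ _ _).
  by rewrite /GRing.scale /= addrK mulrA mulrNN mulVf ?mul1r ?gt_eqF.
have cF : {within `[a, X - e], continuous F}.
  apply: derivable_within_continuous => t; rewrite in_itv/= => /andP[_ tb].
  by case: (dF t (le_lt_trans tb XeX)).
have [|LR D] := derivable_LRcontinuous (F1 := fun t => (X - t) `^ p) aXe cF.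
  by move=> t; rewrite in_itv/= => /andP[_ tb]; apply: dF; exact: lt_trans XeX.
rewrite (continuous_FTC2 aXe (within_continuous_powR_rev XeX) LR D).
rewrite -EFinB lee_fin /F.
have : 0 <= (p + 1)^-1 * (X - (X - e)) `^ (p + 1).
  by rewrite mulr_ge0 ?powR_ge0// invr_ge0 ltW.
by rewrite !mulNr opprK [X in _ <= X]mulrC; lra.
Qed.

Lemma measurable_powR_rev X p (D : set R) :
  measurable_fun D (fun t => (X - t) `^ p).
Proof.
apply: (measurable_funS measurableT) => //.
apply: (measurableT_comp (measurable_powR p)).
exact: measurable_funB.
Qed.

Lemma integrable_powR_rev X p a : a < X -> -1 < p ->
  mu.-integrable `[a, X[ (EFin \o (fun t => (X - t) `^ p)).
Proof.
move=> aX p1; apply/integrableP; split.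
  by apply/measurable_EFinP; exact: measurable_powR_rev.
apply: le_lt_trans (_ : (_ <= ((X - a) `^ (p + 1) / (p + 1))%:E)%E) _;
  last exact: ltry.
apply: le_trans (le_integral_powR_rev aX p1).
rewrite le_eqVlt; apply/orP; left; apply/eqP; apply: eq_integral => t _ /=.
by rewrite ger0_norm ?powR_ge0.
Qed.

Lemma le_Rintegral_powR_rev X p a : a < X -> -1 < p ->
  \int[mu]_(t in `[a, X[) ((X - t) `^ p) <= (X - a) `^ (p + 1) / (p + 1).
Proof.
move=> aX p1; rewrite -lee_fin; apply: le_trans (le_integral_powR_rev aX p1).
rewrite /Rintegral fineK//.
exact: (integrable_fin_num _ (integrable_powR_rev aX p1)).
Qed.

(** The integral of [f1 - chord_slope f a b] vanishes, so the constant
    [(b - a) ^ - alpha], the minimum of the weight, can be subtracted from it.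
    The remaining weight has integral
    [(b - a) ^ (1 - alpha) * (1 / (1 - alpha) - 1)], whose factor [alpha] would
    be lost by bounding the integrand directly. *)
Lemma Rintegral_powR_rev_chord_le f (f1 : R -> R) m (alpha : R) a b :
  a < b -> 0 < alpha -> alpha < 1 -> curvature_le f f1 m a b ->
  `|\int[mu]_(t in `[a, b]) ((b - t) `^ (- alpha) * (f1 t - chord_slope f a b))|
    <= m / 2 * (b - a) * ((b - a) `^ (1 - alpha) * (alpha / (1 - alpha))).
Proof.
move=> ab al0 al1 C; have [cf df cf1 _] := C.
have ba0 : 0 < b - a by rewrite subr_gt0.
have m0 := curvature_ge0 ab C.
pose g t := f1 t - chord_slope f a b.
pose w t := (b - t) `^ (- alpha).
pose W := (b - a) `^ (- alpha).
have p1 : -1 < - alpha by lra.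
have cG : {within `[a, b], continuous (f - chord f a b)}.
  exact: within_continuous_subquad.
have cg : {within `[a, b], continuous g}.
  by move=> t; apply: cvgB; [exact: cf1|exact: cvg_cst].
have sub : `[a, b[ `<=` `[a, b] by apply: subset_itvl; rewrite bnd_simp.
have mg : measurable_fun `[a, b[ g.
  apply: (measurable_funS (E := `[a, b]%classic)) => //.
  exact: subspace_continuous_measurable_fun cg.
have gm t : t \in `[a, b[ -> `|g t| <= m / 2 * (b - a).
  by move=> /sub tab; exact: slope_error_le C tab.
have mD : @measurable _ (measurableTypeR R) `[a, b[%classic by [].

have iw : mu.-integrable `[a, b[ (EFin \o w) by exact: integrable_powR_rev.
have iW : mu.-integrable `[a, b[ (EFin \o cst W).
  apply: (@integrableS _ _ R mu `[a, b]%classic) => //.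
  by apply: within_continuous_integrable; move=> t; exact: cvg_cst.
have ig : mu.-integrable `[a, b[ (EFin \o g).
  apply: (@integrableS _ _ R mu `[a, b]%classic) => //.
  exact: within_continuous_integrable.
have iwW : mu.-integrable `[a, b[ (EFin \o (fun t => w t - W)).
  by have := @integrableB _ _ R mu _ mD _ _ iw iW; exact: eq_integrable.
have iwg := integrable_weight (mu := mu) mD iw mg gm.
have iwWg := integrable_weight (mu := mu) mD iwW mg gm.
have iWg := integrable_weight (mu := mu) mD iW mg gm.
have int_g : \int[mu]_(t in `[a, b[) g t = 0.
  rewrite Rintegral_itv_bndo_bndc//.
  rewrite (Rintegral_derive ab cG cg
    (fun t tab => chord_is_derive a b (df t tab))).
  by rewrite !fctE chordl chordr// !subrr.
(* The weight takes the value 0 at [b], so it is bounded below only on the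
   half-open interval. *)
rewrite -Rintegral_itv_bndo_bndc//.
have -> : \int[mu]_(t in `[a, b[) (w t * g t) =
    \int[mu]_(t in `[a, b[) ((w t - W) * g t).
  transitivity (\int[mu]_(t in `[a, b[) ((w t - W) * g t + W * g t)).
    by apply: eq_Rintegral => t _; ring.
  by rewrite RintegralD// RintegralZl// int_g mulr0 addr0.
apply: le_trans (le_normr_Rintegral_weight (mu := mu) mD iwW mg _ gm) _.
  move=> t; rewrite /= in_itv/= => /andP[ta tb]; rewrite subr_ge0 /W /w !powRN.
  rewrite lef_pV2 ?posrE ?powR_gt0 ?subr_gt0//.
  by apply: ge0_ler_powR; rewrite ?nnegrE ?subr_ge0 ?lerD2l ?lerN2// ltW.
apply: ler_wpM2l; first by rewrite mulr_ge0 ?divr_ge0 // ltW.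
rewrite RintegralB//.
have := le_Rintegral_powR_rev ab p1; rewrite -/w => Iw.
have -> : \int[mu]_(_ in `[a, b[) W = W * (b - a).
  by rewrite Rintegral_cst//= lebesgue_measure_itv/= lte_fin ab.
rewrite [- alpha + 1]addrC in Iw.
apply: le_trans (lerB Iw (lexx _)) _.
have -> : W * (b - a) = (b - a) `^ (1 - alpha).
  rewrite mulrC /W -[X in X * _](@powRr1 _ (b - a)) ?ltW// -powRD//.
  by rewrite (gt_eqF ba0) implybT.
rewrite le_eqVlt; apply/orP; left; apply/eqP; field.
by rewrite subr_eq0 gt_eqF.
Qed.

Lemma Rintegral_bounded_le a b C (v : R -> R) : a <= b ->
  measurable_fun `[a, b] v -> (forall t, t \in `[a, b] -> `|v t| <= C) ->
  `|\int[mu]_(t in `[a, b]) v t| <= C * (b - a).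
Proof.
move=> ab mv vC; rewrite -Rintegral_itv_one//.
have := @le_normr_Rintegral_weight _ _ _ mu `[a, b]%classic (cst 1) v C
  _ _ mv _ vC.
rewrite /=; under eq_Rintegral do rewrite mul1r.
apply => //.
by apply: within_continuous_integrable => t; exact: cvg_cst.
Qed.

End weighted_integrals.

(** * The error of the scheme *)

Section scheme.
Context {R : realType}.
Notation mu := (@lebesgue_measure R).
Implicit Types (f phi : R -> R) (a b m t h X M : R).

(** Continuity of the second derivative makes its maximum an upper bound: the
    supremum of an unbounded set would be a default value. *)
Lemma C2_on_curvature_le a b phi : a < b -> C2_on a b phi ->
  let A := `[a, b]%classic in
  let phi1 := derive1_on A phi in
  curvature_le phi phi1 (max_on a b (fun t => `|derive1_on A phi1 t|)) a b.
Proof.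
move=> ab [d1 d2 c2] A phi1.
have inA t : t \in `]a, b[ -> A t /\ nbhs t A.
  move=> tab; split; first exact: subset_itv_oo_cc tab.
  by apply: filterS (near_in_itvoo tab) => s; exact: subset_itv_oo_cc.
split.
- exact: derivable1_on_continuous d1.
- by move=> t /inA[At nA]; apply: derivable1_on_is_derive => //; exact: d1.
- exact: derivable1_on_continuous d2.
- move=> t /inA[At nA]; exists (derive1_on A phi1 t).
    by apply: derivable1_on_is_derive => //; exact: d2.
  have cn : {within `[a, b], continuous (fun t => `|derive1_on A phi1 t|)}.
    by move=> s; apply: cvg_norm; exact: c2.
  have [c _ [-> cmax]] := max_on_attained (ltW ab) cn.
  exact: cmax.
Qed.

Lemma within_continuous_section (U V W : topologicalType) (A : set U)
    (B : set V) (K : U * V -> W) (s : U) :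
  {within A `*` B, continuous K} -> A s ->
  {within B, continuous (fun r => K (s, r))}.
Proof.
move=> cK As; apply/subspace_continuousP => r0 Bt P KP.
have Kst : K @ within (A `*` B) (nbhs (s, r0)) --> K (s, r0).
  by move/subspace_continuousP : cK; apply.
have nQ : nbhs (s, r0) [set p | (A `*` B) p -> P (K p)] := Kst P KP.
have st : (s, r) @[r --> r0] --> (s, r0).
  by apply: cvg_pair; [exact: cvg_cst|exact: cvg_id].
have : nbhs r0 [set r | (A `*` B) (s, r) -> P (K (s, r))] := st _ nQ.
by apply: (@filterS _ (nbhs r0)) => r /= PK Br; exact: PK.
Qed.

Lemma nodeB h j : node h j.+1 - node h j = h.
Proof. by rewrite /node -mulrBl -natrB// subSnn mul1r. Qed.

Lemma node_lt h j : 0 < h -> node h j < node h j.+1.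
Proof. by move=> h0; rewrite -subr_gt0 nodeB. Qed.

Lemma node_le h i j : 0 < h -> (i <= j)%N -> node h i <= node h j.
Proof. by move=> h0 ij; rewrite /node ler_pM2r// ler_nat. Qed.

Lemma slopeE phi h j : slope phi h j = chord_slope phi (node h j) (node h j.+1).
Proof. by rewrite /chord_slope nodeB. Qed.

Lemma interpolantE phi h j t : 0 < h ->
  interpolant phi h j t = chord phi (node h j) (node h j.+1) t.
Proof.
move=> h0; rewrite /interpolant /chord /quad -slopeE /slope.
have -> : node h j.+1 = node h j + h.
  by rewrite -[X in _ + X](nodeB h j) addrC subrK.
by field; rewrite gt_eqF.
Qed.

Lemma curvature_le_node phi (phi1 : R -> R) m h k j : 0 < h -> (j < k)%N ->
  curvature_le phi phi1 m (node h 0) (node h k) ->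
  curvature_le phi phi1 m (node h j) (node h j.+1).
Proof.
by move=> h0 jk; apply: curvature_leW; rewrite in_itv/= !node_le// ltnW.
Qed.

Lemma Rintegral_powR_rev_chord_interior_le f (f1 : R -> R) m (alpha : R) a b X :
  a < b -> b < X -> 0 < alpha -> curvature_le f f1 m a b ->
  `|\int[mu]_(t in `[a, b]) ((X - t) `^ (- alpha) * (f1 t - chord_slope f a b))|
    <= m / 8 * (b - a) ^+ 2 * ((X - b) `^ (- alpha) - (X - a) `^ (- alpha)).
Proof.
move=> ab bX al0 C.
apply: (@Rintegral_weight_chord_le _ _ _ _ (fun t => (X - t) `^ (- alpha))
  (fun t => - - alpha * (X - t) `^ (- alpha - 1))) => //.
- exact: within_continuous_powR_rev.
- by move=> t; apply: cvgM; [exact: cvg_cst|exact: within_continuous_powR_rev].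
- move=> t; rewrite in_itv/= => /andP[_ tb]; apply: is_derive_powR_rev.
  exact: lt_trans bX.
- by move=> t _; rewrite opprK mulr_ge0 ?powR_ge0// ltW.
Qed.

Lemma caputo_error_le phi (phi1 : R -> R) m (alpha : R) h k :
  0 < h -> (0 < k)%N -> 0 < alpha -> alpha < 1 ->
  curvature_le phi phi1 m (node h 0) (node h k) ->
  `|\sum_(0 <= j < k) \int[mu]_(t in `[node h j, node h j.+1])
      ((node h k - t) `^ (- alpha) * (phi1 t - slope phi h j))|
  <= (8^-1 + alpha / ((1 - alpha) * (2 - alpha))) * m * h `^ (2 - alpha).
Proof.
move=> h0 + al0 al1; case: k => // k _ C.
have m0 : 0 <= m.
  by apply: curvature_ge0 C; rewrite (lt_le_trans (node_lt 0 h0))// node_le.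
set X := node h k.+1.
rewrite big_nat_recr//=.
have Xk : X - node h k = h by exact: nodeB.
have last_le : `|\int[mu]_(t in `[node h k, X])
      ((X - t) `^ (- alpha) * (phi1 t - slope phi h k))|
    <= m / 2 * h * (h `^ (1 - alpha) * (alpha / (1 - alpha))).
  rewrite slopeE; have := curvature_le_node h0 (ltnSn k) C.
  move=> /(Rintegral_powR_rev_chord_le (node_lt k h0) al0 al1).
  by rewrite -/X Xk.
pose w j := (X - node h j) `^ (- alpha).
have init_le : `|\sum_(0 <= j < k) \int[mu]_(t in `[node h j, node h j.+1])
      ((X - t) `^ (- alpha) * (phi1 t - slope phi h j))|
    <= m / 8 * h ^+ 2 * h `^ (- alpha).
  apply: le_trans (ler_norm_sum _ _ _) _.
  apply: le_trans
    (_ : \sum_(0 <= j < k) (m / 8 * h ^+ 2 * (w j.+1 - w j)) <= _).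
    rewrite big_nat [leRHS]big_nat; apply: ler_sum => j /= jk.
    rewrite slopeE; have := curvature_le_node h0 (ltnW jk : (j < k.+1)%N) C.
    have jX : node h j.+1 < X.
      by rewrite (le_lt_trans (node_le h0 jk))// node_lt.
    move=> /(Rintegral_powR_rev_chord_interior_le (node_lt j h0) jX al0).
    by rewrite nodeB.
  rewrite -mulr_sumr telescope_sumr// /w Xk.
  apply: ler_wpM2l; first by rewrite mulr_ge0 ?divr_ge0 ?sqr_ge0.
  by rewrite gerBl powR_ge0.
have hD p : h * h `^ p = h `^ (1 + p).
  by rewrite -[X in X * _](@powRr1 _ h) ?ltW// -powRD// (gt_eqF h0) implybT.
have h2 : h ^+ 2 * h `^ (- alpha) = h `^ (2 - alpha).
  by rewrite expr2 -mulrA !hD; congr (_ `^ _); ring.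
have h1 : h * h `^ (1 - alpha) = h `^ (2 - alpha).
  by rewrite hD; congr (_ `^ _); ring.
apply: le_trans (ler_normD _ _) _; apply: le_trans (lerD init_le last_le) _.
rewrite -mulrA h2 -[m / 2 * h * _]mulrA [h * (_ * _)]mulrA h1.
have hp := powR_ge0 h (2 - alpha); set H := h `^ _ in hp *.
have -> : m / 8 * H + m / 2 * (H * (alpha / (1 - alpha))) =
    (8^-1 + alpha / (1 - alpha) * 2^-1) * m * H by field; lra.
apply: ler_wpM2r => //; apply: ler_wpM2r => //; apply: lerD => //.
(* The last cell gives [1 / 2], the statement has [1 / (2 - alpha)]. *)
rewrite invfM mulrA; apply: ler_wpM2l; first by rewrite divr_ge0 ?subr_ge0 ?ltW.
by rewrite lef_pV2 ?posrE; lra.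
Qed.

Lemma kernel_error_le phi (phi1 : R -> R) (q : R -> R) m M h k :
  0 < h -> 0 <= M ->
  curvature_le phi phi1 m (node h 0) (node h k) ->
  {within `[node h 0, node h k], continuous q} ->
  (forall t, t \in `[node h 0, node h k] -> `|q t| <= M) ->
  `|\sum_(0 <= j < k) \int[mu]_(t in `[node h j, node h j.+1])
      (q t * (phi t - interpolant phi h j t))|
  <= M / 8 * m * node h k * h ^+ 2.
Proof.
move=> h0 M0 C cq qM.
apply: le_trans (ler_norm_sum _ _ _) _.
apply: le_trans (_ : \sum_(0 <= j < k) (M * (m / 8 * h ^+ 2) * h) <= _);
  last first.
  rewrite sumr_const_nat subn0 /node -[X in X <= _]mulr_natl le_eqVlt.
  by apply/orP; left; apply/eqP; ring.
rewrite big_nat [leRHS]big_nat; apply: ler_sum => j /= jk.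
have Cj := curvature_le_node h0 jk C; have jj := node_lt j h0.
rewrite -[X in _ <= _ * X](nodeB h j).
have sub : `[node h j, node h j.+1] `<=` `[node h 0, node h k].
  by apply: itv_subset_trans; rewrite in_itv/= !node_le// ltnW.
have -> : \int[mu]_(t in `[node h j, node h j.+1])
      (q t * (phi t - interpolant phi h j t)) =
   \int[mu]_(t in `[node h j, node h j.+1])
      (q t * (phi - chord phi (node h j) (node h j.+1)) t).
  by apply: eq_Rintegral => t _; rewrite interpolantE.
apply: Rintegral_bounded_le; first exact: ltW.
- have cv : {within `[node h j, node h j.+1],
      continuous (fun t => q t * (phi - chord phi (node h j) (node h j.+1)) t)}.
    move=> t; apply: cvgM; first by apply: (continuous_subspaceW sub cq).
    by apply: within_continuous_subquad; case: Cj.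
  exact: subspace_continuous_measurable_fun cv.
- move=> t tj; rewrite normrM; apply: ler_pM => //; first exact/qM/sub.
  by have := chord_error_le jj Cj tj; rewrite nodeB.
Qed.

Lemma Gamma_ge0 (s : R) : 0 <= Gamma s.
Proof.
by apply: Rintegral_ge0 => t _; rewrite mulr_ge0 ?powR_ge0 ?expR_ge0.
Qed.

End scheme.

Theorem theorem4p1 (R : realType) (alpha : R) (n k : nat) (phi : R -> R)
    (K : R * R -> R) (M : R) :
  let h : R := n%:R^-1 in
  let x := node h in
  let A := `[x 0%N, x k]%classic in
  let phi'' := derive1_on A (derive1_on A phi) in
  let maxphi'' := max_on (x 0%N) (x k) (fun tau => `|phi'' tau|) in
  0 < alpha -> alpha < 1 ->
  (1 <= n)%N -> (1 <= k)%N -> (k <= n)%N ->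
  C2_on (x 0%N) (x k) phi ->
  {within `[0, 1]%classic `*` `[0, 1]%classic, continuous K} ->
  0 < M ->
  (forall s tau : R, 0 <= s <= 1 -> 0 <= tau <= 1 -> `|K (s, tau)| <= M) ->
  `|linear_scheme_error K k phi h alpha| <=
    (Gamma (1 - alpha))^-1
      * (8^-1 + alpha / ((1 - alpha) * (2 - alpha)))
      * maxphi'' * h `^ (2 - alpha)
    + M / 8 * maxphi'' * x k * h ^+ 2.
Proof.
move=> h x A phi'' m al0 al1 n0 k0 kn Cphi cK M0 KM.
have h0 : 0 < h by rewrite invr_gt0 ltr0n.
have x0 : x 0%N = 0 by rewrite /x /node mul0r.
have xk0 : x 0%N < x k by rewrite (lt_le_trans (node_lt 0 h0))// node_le.
have xk1 : x k <= 1 by rewrite /x /node ler_pdivrMr ?ltr0n// mul1r ler_nat.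
have sub t : t \in `[x 0%N, x k] -> 0 <= t <= 1.
  by rewrite in_itv/= x0 => /andP[-> txk]; exact: le_trans xk1.
have xkI : 0 <= x k <= 1 by apply: sub; rewrite in_itv/= lexx ltW.
have C := C2_on_curvature_le xk0 Cphi.
have cq : {within `[x 0%N, x k], continuous (fun t => K (x k, t))}.
  have sub01 : `[x 0%N, x k]%classic `<=` `[0, 1]%classic.
    by move=> t /= /sub; rewrite in_itv.
  apply: continuous_subspaceW sub01 _.
  by apply: within_continuous_section cK _; rewrite /= in_itv.
have caputo := caputo_error_le h0 k0 al0 al1 C.
have kernel := kernel_error_le h0 (ltW M0) C cq
  (fun t tx => KM _ _ xkI (sub t tx)).
rewrite /linear_scheme_error; apply: le_trans (ler_normB _ _) _.
apply: lerD; last exact: kernel.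
have G0 : 0 <= (Gamma (1 - alpha))^-1 by rewrite invr_ge0 Gamma_ge0.
by rewrite normrM (ger0_norm G0) -!mulrA ler_wpM2l// mulrA.
Qed.
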